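(* Let $S : X \to X$, $X = \Sigma_M^+ \times \widehat{\mathbb{C}}$, be the skew-product map associated with rational maps $R_1, \dots, R_M$ of the Riemann sphere, at least one of which has degree at least $2$. Let $f : X \to \mathbb{R}$ be a function. Suppose there exists a constant $\lambda_f > 1$ such that $E_S(f,n) \asymp (\lambda_f)^n$, i.e. there exist constants $\kappa_1, \kappa_2 > 0$ with $\kappa_1 \lambda_f^n \le E_S(f,n) \le \kappa_2 \lambda_f^n$ for all integers $n \ge 1$. Then $$\sum_{1 \le n \le N} \frac{C_S(f,n)}{\lambda_f^n} \asymp \log N,$$ i.e. there exist constants $\sigma_3, \sigma_4 > 0$ such that $\sigma_3 \log N \le \sum_{1 \le n \le N} C_S(f,n)\,\lambda_f^{-n} \le \sigma_4 \log N$ for all integers $N \ge 2$.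
   Context: Let $R_1, \dots, R_M$ be finitely many rational maps acting on the Riemann sphere $\widehat{\mathbb{C}} = \mathbb{C} \cup \{\infty\}$, of degrees $r_1, \dots, r_M$ respectively, with at least one of the degrees at least $2$. Let $\Sigma_M^+$ be the set of infinite words $\omega = (\omega_1 \omega_2 \cdots)$ with letters in $\{1, \dots, M\}$, and let $\sigma$ be the shift, $(\sigma\omega)_j = \omega_{j+1}$ for $j \ge 1$. The skew-product map $S : X \to X$, $X = \Sigma_M^+ \times \widehat{\mathbb{C}}$, is $S(\omega, z_0) = (\sigma\omega, R_{\omega_1} z_0)$. For an integer $n \ge 1$, $\mathrm{Per}_n(S)$ is the set of points $p \in X$ with $S^n p = p$; the prime period $n_p$ of a periodic point $p$ is the least positive integer $m$ with $S^m p = p$. $\mathscr{O}_n(S)$ denotes the collection of all closed orbits of length $n$, i.e. sets $\tau = \{p, Sp, \dots, S^{n-1}p\}$ where $p$ is a periodic point with prime period exactly $n$. For $f : X \to \mathbb{R}$ the $n$-th ergodic sum is $f^n(p) = \sum_{j=0}^{n-1} f(S^j p)$, and for $\tau = \{p, Sp, \dots, S^{n-1}p\} \in \mathscr{O}_n(S)$ one puts $f^n(\tau) = f^n(p)$ (independent of the choice of $p \in \tau$). Define $$E_S(f,n) = \sum_{p \in \mathrm{Per}_n(S)} e^{f^{n_p}(p)}, \qquad C_S(f,n) = \sum_{\tau \in \mathscr{O}_n(S)} e^{f^n(\tau)}.$$ Sums of positive terms are understood a priori with values in $[0,\infty]$. *)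

(* Defs.v *)
From HB Require Import structures.
From mathcomp Require Import all_boot all_order all_algebra.
From mathcomp Require Import all_classical all_reals all_analysis.
From mathcomp Require Import complex.

Set Implicit Arguments.
Unset Strict Implicit.
Unset Printing Implicit Defensive.

Import Order.TTheory GRing.Theory Num.Theory.

Local Open Scope classical_set_scope.
Local Open Scope ring_scope.

(* The Riemann sphere C u {oo}; [None] is the point at infinity. *)
Definition sphere (R : realType) := option R[i].

(* A rational map P/Q in lowest terms. As [coprimep 0 Q] holds exactly when Q
   is a nonzero constant (and symmetrically), P and Q are not both zero; Q = 0
   is possible only for the constant map oo. *)
Record rational_map (R : realType) := RationalMap {
  rat_num : {poly R[i]};
  rat_den : {poly R[i]};
  rat_coprime : coprimep rat_num rat_den
}.

Definition rat_degree (R : realType) (r : rational_map R) : nat :=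
  (maxn (size (rat_num r)) (size (rat_den r))).-1.

(* By coprimality P and Q never vanish together at a finite point; the value at
   infinity is the quotient of the coefficients of degree d = max(deg P, deg Q),
   which are not both zero. *)
Definition rat_act (R : realType) (r : rational_map R) (z : sphere R) :
    sphere R :=
  let quot (a b : R[i]) : sphere R := if b == 0 then None else Some (a / b) in
  match z with
  | Some x => quot (rat_num r).[x] (rat_den r).[x]
  | None => quot (rat_num r)`_(rat_degree r) (rat_den r)`_(rat_degree r)
  end.

(* Infinite words; the letter omega_j (j >= 1) is [omega j.-1]. *)
Definition words (M : nat) := nat -> 'I_M.

Definition shift (M : nat) (omega : words M) : words M :=
  fun j => omega j.+1.

Definition skew_space (R : realType) (M : nat) : choiceType :=
  (words M * sphere R)%type.

Definition skew_product (R : realType) (M : nat)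
    (Rs : 'I_M -> rational_map R) (p : skew_space R M) : skew_space R M :=
  (shift p.1, rat_act (Rs (p.1 0%N)) p.2).

Definition Per (X : choiceType) (S : X -> X) (n : nat) : set X :=
  [set p | iter n S p = p].

Definition is_prime_period (X : choiceType) (S : X -> X) (p : X) (m : nat) :=
  [/\ (0 < m)%N, iter m S p = p &
      forall k, (0 < k)%N -> iter k S p = p -> (m <= k)%N].

(* Equal to 0 when p is not periodic. *)
Definition prime_period (X : choiceType) (S : X -> X) (p : X) : nat :=
  xget 0%N [set m | is_prime_period S p m].

Definition orbit_seg (X : choiceType) (S : X -> X) (n : nat) (p : X) : set X :=
  [set iter j S p | j in `I_n].

Definition closed_orbits (X : choiceType) (S : X -> X) (n : nat) :
    set (set X) :=
  [set tau | exists2 p, is_prime_period S p n & tau = orbit_seg S n p].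

Definition ergodic_sum (R : realType) (X : choiceType) (S : X -> X)
    (f : X -> R) (n : nat) (p : X) : R :=
  \sum_(0 <= j < n) f (iter j S p).

(* f^n(tau) = f^n(p) for a chosen p in tau; on a closed orbit of length n the
   value does not depend on the choice. *)
Definition orbit_sum (R : realType) (X : choiceType) (S : X -> X)
    (f : X -> R) (n : nat) (tau : set X) : R :=
  xget 0 [set ergodic_sum S f n p | p in tau].

Definition E_sum (R : realType) (X : choiceType) (S : X -> X)
    (f : X -> R) (n : nat) : \bar R :=
  \esum_(p in Per S n) (expR (ergodic_sum S f (prime_period S p) p))%:E.

Definition C_sum (R : realType) (X : choiceType) (S : X -> X)
    (f : X -> R) (n : nat) : \bar R :=
  \esum_(tau in closed_orbits S n) (expR (orbit_sum S f n tau))%:E.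

(* a n and b n are comparable up to positive constants for all n >= n0. *)
Definition asymp_from (R : realType) (n0 : nat) (a : nat -> \bar R)
    (b : nat -> R) : Prop :=
  exists k1 k2 : R, [/\ 0 < k1, 0 < k2 &
    forall n, (n0 <= n)%N ->
      ((k1 * b n)%:E <= a n)%E /\ (a n <= (k2 * b n)%:E)%E].

(* Main.v *)
Require Import Defs.
From HB Require Import structures.
From mathcomp Require Import all_boot all_order all_algebra.
From mathcomp Require Import all_classical all_reals all_analysis.
From mathcomp Require Import complex.
From mathcomp Require Import ring lra zify.

Import Order.TTheory GRing.Theory Num.Theory.

Local Open Scope classical_set_scope.
Local Open Scope ring_scope.

(** Every point of Per_n(S) has a prime period d dividing n, and the points of
prime period d split into closed orbits of length d, on each of which the
d-th ergodic sum is constant. Hence, with values in [0, +oo],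

  E_S(f,n) = sum over d | n of d C_S(f,d)                       ([E_sumE])

for any self-map S of any set. What remains is a statement about a real
sequence c_n >= 0: if e_n = sum over d | n of d c_d lies between k1 lambda^n
and k2 lambda^n, then the partial sums of c_n / lambda^n grow like log N
([partial_sums_asymp_ln]).

Upper bound: n c_n <= e_n, so c_n / lambda^n <= k2 / n, and the harmonic sums
are O(log N).

Lower bound: a proper divisor d of n satisfies d <= n/2, and d c_d <=
k2 lambda^d. Writing k = n - d, this gives

  c_n / lambda^n >= k1 / n - (k2 / n) sum over n/2 <= k < n of lambda^(-k).

When the error term is summed over n and the two sums are exchanged, a given k
receives the weights 1/n for k < n <= 2k, whose total is at most 1. The error
is therefore at most k2 times a geometric series, a constant D independent of
N, and the partial sums are at least k1 log N - D. This is vacuous for small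
N; there one uses instead that the n = 1 term alone is c_1 / lambda =
e_1 / lambda >= k1, and the two bounds combine into a multiple of log N valid
for every N >= 2. *)

(** * Periodic points and closed orbits of a self-map *)

Section PeriodicPoints.
Context {X : choiceType} (S : X -> X).
Implicit Types (p q : X) (n m d i j k : nat).

Lemma iter_fixM n k p : iter n S p = p -> iter (k * n) S p = p.
Proof.
move=> Sp; elim: k => [//|k IHk].
by rewrite mulSn iterD IHk.
Qed.

Lemma iter_modn n k p : iter n S p = p -> iter k S p = iter (k %% n) S p.
Proof.
by move=> Sp; rewrite {1}(divn_eq k n) addnC iterD iter_fixM.
Qed.

(** On a closed orbit the map is invertible: j further turns around the orbit,
each one step short, undo j steps. *)
Lemma iter_return {n} j {p} : iter n S p = p -> (0 < n)%N ->
  iter (j * n.-1) S (iter j S p) = p.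
Proof.
move=> Sp n0; rewrite -iterD -[X in (_ + X)%N]muln1 -mulnDr addn1 prednK//.
exact: iter_fixM.
Qed.

Lemma is_prime_period_dvd p m n :
  is_prime_period S p m -> iter n S p = p -> (m %| n)%N.
Proof.
move=> [m0 Sm min_m] Sn; apply/eqP/eqP; rewrite /dvdn.
case: (posnP (n %% m)%N) => [//|r0].
have := min_m _ r0; rewrite -iter_modn// => /(_ Sn).
by rewrite leqNgt ltn_mod m0.
Qed.

(** A return of S^j p to itself after k steps can be transported back to p by
[iter_return], so all points of an orbit have the same return times. *)
Lemma is_prime_period_iter p n j :
  is_prime_period S p n -> is_prime_period S (iter j S p) n.
Proof.
move=> [n0 Sn min_n]; split => //; first by rewrite -iterD addnC iterD Sn.
move=> k k0 /(congr1 (iter (j * n.-1) S)).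
rewrite (iter_return j Sn n0) -!iterD (addnC _ k) -addnA iterD iterD.
rewrite iter_return//.
exact: min_n.
Qed.

Lemma exists_prime_period p n :
  (0 < n)%N -> iter n S p = p -> exists m, is_prime_period S p m.
Proof.
move=> n0 Sn.
have ex : exists m, (0 < m)%N && (iter m S p == p).
  by exists n; rewrite n0; apply/eqP.
case: (ex_minnP ex) => m /andP[m0 /eqP Sm] min_m; exists m; split => // k k0 Sk.
by apply: min_m; rewrite k0; apply/eqP.
Qed.

Lemma is_prime_period_unique p m n :
  is_prime_period S p m -> is_prime_period S p n -> m = n.
Proof.
move=> [m0 Sm min_m] [n0 Sn min_n].
by apply/eqP; rewrite eqn_leq min_m// min_n.
Qed.

Lemma prime_periodE p n : is_prime_period S p n -> prime_period S p = n.
Proof.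
by move=> Sn; apply: xget_unique => // m /is_prime_period_unique; exact.
Qed.

Lemma orbit_seg_sub p q n : (0 < n)%N -> iter n S p = p ->
  orbit_seg S n p q -> orbit_seg S n q `<=` orbit_seg S n p.
Proof.
move=> n0 Sn [j _ <-] _ [i _ <-].
exists ((i + j) %% n)%N; first by rewrite /= ltn_mod.
by rewrite -iter_modn// iterD.
Qed.

(** Distinct closed orbits are disjoint: an orbit is determined by any one of
its points. *)
Lemma orbit_seg_eq p q n : is_prime_period S p n ->
  orbit_seg S n p q -> orbit_seg S n q = orbit_seg S n p.
Proof.
move=> Pp pq; have [n0 Sn _] := Pp; apply/seteqP; split.
  exact: orbit_seg_sub.
case: pq => j _ <-; have [_ Sjn _] := is_prime_period_iter p n j Pp.
apply: orbit_seg_sub => //.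
exists ((j * n.-1) %% n)%N; first by rewrite /= ltn_mod.
by rewrite -iter_modn// iter_return.
Qed.

Lemma orbit_seg_self p n : (0 < n)%N -> orbit_seg S n p p.
Proof. by move=> n0; exists 0%N. Qed.

(** A coincidence S^i p = S^j p with i < j < n would give S^i p the period
j - i < n; so a closed orbit of length n has exactly n points. *)
Lemma iter_inj_orbit p n : is_prime_period S p n ->
  set_inj `I_n (fun j => iter j S p).
Proof.
move=> Pp.
suff lt_neq i j : (i < j)%N -> (j < n)%N -> iter i S p <> iter j S p.
  move=> i j /set_mem/= lt_in /set_mem/= lt_jn Eij.
  by case: (ltngtP i j) => // lt; [case: (lt_neq i j)|case: (lt_neq j i)].
move=> lt_ij lt_jn Eij.
have [_ _ min_n] := is_prime_period_iter p n i Pp.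
have := min_n (j - i)%N; rewrite -iterD subnK ?(ltnW lt_ij)// subn_gt0.
move=> /(_ lt_ij (esym Eij)); rewrite leqNgt => /negP; apply.
by apply: leq_ltn_trans lt_jn; exact: leq_subr.
Qed.

Lemma Per_bigcup n : (0 < n)%N ->
  Per S n = \bigcup_(d in [set d | (0 < d)%N && (d %| n)%N])
              [set p | is_prime_period S p d].
Proof.
move=> n0; apply/seteqP; split => [p /= Sn|p [d /= /andP[d0 /dvdnP[k ->]]]].
  have [d Pd] := exists_prime_period p n n0 Sn; exists d => //=.
  by rewrite (is_prime_period_dvd p d n)// andbT; case: Pd.
by case=> _ Sd _; exact: iter_fixM.
Qed.

End PeriodicPoints.

(** * Orbit sums and the divisor formula *)

Lemma mule_natl_sum (R : realType) n (x : \bar R) :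
  (n%:R%:E * x = \sum_(i < n) x)%E.
Proof.
rewrite big_const_ord; elim: n => [|n IHn] /=; first by rewrite mul0e.
by rewrite -natr1 EFinD ge0_muleDl ?lee_fin// IHn mul1e addeC.
Qed.

Section OrbitSums.
Context {R : realType} {X : choiceType} (S : X -> X) (f : X -> R).
Implicit Types (p q : X) (n j : nat).

(** One step along a closed orbit only moves the term f(p) from the start of
the sum to its end. *)
Lemma ergodic_sum_iter p n j : iter n S p = p ->
  ergodic_sum S f n (iter j S p) = ergodic_sum S f n p.
Proof.
move=> Sn; elim: j => [//|j <-].
have Sjn : iter n S (iter j S p) = iter j S p by rewrite -iterD addnC iterD Sn.
rewrite iterS.
move: (iter j S p) Sjn => q Sq.
rewrite /ergodic_sum.
under eq_bigr do rewrite -iterSr.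
case: n Sq {Sn} => [|n Sq]; first by rewrite !big_geq.
by rewrite big_nat_recr//= big_nat_recl//=; move: Sq => /= ->; rewrite addrC.
Qed.

Lemma orbit_sumE p n : is_prime_period S p n ->
  orbit_sum S f n (orbit_seg S n p) = ergodic_sum S f n p.
Proof.
move=> [n0 Sn _]; apply: xget_unique.
  by exists p => //; exact: orbit_seg_self.
by move=> _ [_ [j _ <-] <-]; exact: ergodic_sum_iter.
Qed.

(** Grouping the points by closed orbit: each orbit contributes n equal
terms. The grouping is a reindexing of the sum over pairs (orbit, point of the
orbit) by the second component. *)
Lemma esum_prime_period n : (0 < n)%N ->
  (\esum_(p in [set p | is_prime_period S p n])
     (expR (ergodic_sum S f n p))%:E = n%:R%:E * C_sum S f n)%E.
Proof.
move=> n0; rewrite mule_natl_sum /C_sum -esum_sum; last first.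
  by move=> *; rewrite lee_fin expR_ge0.
transitivity (\esum_(tau in closed_orbits S n) \esum_(p in tau)
   (expR (ergodic_sum S f n p))%:E)%E; last first.
  apply: eq_esum => _ [p Pp ->].
  rewrite orbit_sumE// /orbit_seg esum_image; last exact: iter_inj_orbit.
  have [_ Sn _] := Pp.
  under eq_esum do rewrite ergodic_sum_iter//.
  rewrite esum_fset//.
  by rewrite -fsbig_ord.
rewrite esum_esum; last by move=> *; rewrite lee_fin expR_ge0.
apply: (@reindex_esum _ _ _ _ _ snd (fun p => (expR (ergodic_sum S f n p))%:E)).
split.
- move=> [_ _] [[p Pp ->]] /= [j _ <-]; exact: is_prime_period_iter.
(* two orbits through the same point are equal *)
- move=> [_ q] [_ q'] /set_mem[/= [p Pp ->] pq] /set_mem[/= [p' Pp' ->] pq'].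
  move=> /= Eqq; rewrite -Eqq in pq' *.
  by rewrite -(orbit_seg_eq S p q n)// -(orbit_seg_eq S p' q n).
- move=> p /= Pp; exists (orbit_seg S n p, p) => //; split => /=.
    by exists p.
  by apply: orbit_seg_self.
Qed.

Lemma C_sum_ge0 n : (0 <= C_sum S f n)%E.
Proof. by apply: esum_ge0 => tau _; rewrite lee_fin expR_ge0. Qed.

Lemma E_sumE n : (0 < n)%N ->
  (E_sum S f n =
   \sum_(1 <= d < n.+1 | (d %| n)%N) d%:R%:E * C_sum S f d)%E.
Proof.
move=> n0; rewrite /E_sum Per_bigcup// esum_bigcupT; last 2 first.
- by apply/trivIsetP => d d' _ _ /eqP ne; apply/seteqP; split => // p [/= Pd];
    move/(is_prime_period_unique _ _ _ _ Pd)/ne.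
- by move=> p; rewrite lee_fin expR_ge0.
transitivity (\esum_(d in [set` [seq d <- index_iota 1 n.+1 | (d %| n)%N]])
   (d%:R%:E * C_sum S f d))%E.
  rewrite (_ : [set` _] = [set d | (0 < d)%N && (d %| n)%N]); last first.
    apply/seteqP; split => d /=; rewrite mem_filter mem_index_iota.
      by case/and3P => -> ->.
    by move=> /andP[-> dn]; rewrite dn ltnS dvdn_leq.
  apply: eq_esum => d /andP[d0 _]; rewrite -esum_prime_period//.
  by apply: eq_esum => p /= Pp; rewrite (prime_periodE S p d).
rewrite esum_fset; last 2 first.
- exact: finite_seq.
- by move=> d _; rewrite mule_ge0 ?lee_fin// C_sum_ge0.
rewrite -[RHS]big_filter; apply/esym/fsbig_seq.
by rewrite filter_uniq ?iota_uniq.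
Qed.

Lemma C_sum_le_E_sum n : (0 < n)%N ->
  (n%:R%:E * C_sum S f n <= E_sum S f n)%E.
Proof.
move=> n0; rewrite E_sumE// big_mkcond big_nat_recr//= dvdnn leeDr//.
apply: sume_ge0 => d _; case: ifP => // _.
by rewrite mule_ge0 ?lee_fin// C_sum_ge0.
Qed.

End OrbitSums.

(** * Harmonic and geometric sums *)

Section Elementary.
Context {R : realType}.
Implicit Types (N n k d : nat) (lambda : R).

Lemma ln_le_harmonic N : (0 < N)%N ->
  ln N%:R <= \sum_(1 <= n < N.+1) n%:R^-1 :> R.
Proof.
suff lnS m : ln m.+1%:R <= \sum_(1 <= n < m.+1) n%:R^-1 :> R.
  case: N => // N _; apply: le_trans (lnS N) _.
  by rewrite [leRHS]big_nat_recr//= lerDl invr_ge0.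
elim: m => [|m IHm]; first by rewrite big_geq// ln1.
rewrite big_nat_recr//=.
have -> : m.+2%:R = m.+1%:R * (1 + m.+1%:R^-1) :> R.
  by rewrite mulrDr mulfV ?pnatr_eq0// mulr1 -natr1.
have m0 : 0 < m.+1%:R^-1 :> R by rewrite invr_gt0.
rewrite lnM ?posrE ?addr_gt0//.
by apply: lerD => //; apply: le_ln1Dx; apply: lt_trans m0; rewrite ltrN10.
Qed.

Lemma harmonic_le_ln N : (0 < N)%N ->
  \sum_(1 <= n < N.+1) n%:R^-1 <= 1 + ln N%:R :> R.
Proof.
elim: N => // -[|N] IHN _; first by rewrite big_nat1 ln1 invr1 addr0.
rewrite big_nat_recr//=; move: (IHN isT) => {IHN}.
set H := \sum_(_ <= _ < _) _ => IHN.
have N0 : N.+2%:R != 0 :> R by rewrite pnatr_eq0.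
have le1 : N.+2%:R^-1 < 1 :> R by rewrite invf_lt1 ?ltr1n.
have : ln (1 + - N.+2%:R^-1) <= - N.+2%:R^-1 :> R.
  by apply: le_ln1Dx; rewrite ltrN2.
have -> : 1 + - N.+2%:R^-1 = N.+1%:R / N.+2%:R :> R.
  rewrite -[X in X - _](mulfV N0) -[X in _ - X]mul1r -mulrBl.
  by rewrite -[N.+2]addn1 natrD addrK.
rewrite ln_div ?posrE// => ln_step.
apply: le_trans (lerD IHN (lexx _)) _.
by rewrite -addrA lerD2l -lerBrDl -lerN2 opprB.
Qed.

(** The window (k, 2k] contains at most k integers, each of weight less
than 1/k. *)
Lemma sum_window_le1 k N : (0 < k)%N ->
  \sum_(1 <= n < N | (k < n <= k.*2)%N) n%:R^-1 <= 1 :> R.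
Proof.
move=> k0; have k0R : (k%:R : R) != 0 by rewrite pnatr_eq0 -lt0n.
apply: (@le_trans _ _ (\sum_(1 <= n < N | (k < n <= k.*2)%N) k%:R^-1)).
  apply: ler_sum => n /andP[kn _].
  have n0 := ltn_trans k0 kn.
  by rewrite lef_pV2 ?posrE ?ltr0n// ler_nat ltnW.
rewrite big_const_seq iter_addr_0 -[leRHS](mulVf k0R) -[leLHS]mulr_natr.
rewrite ler_wpM2l ?invr_ge0// ler_nat -size_filter.
rewrite -[leqRHS](size_iota k.+1); apply: uniq_leq_size.
  by rewrite filter_uniq ?iota_uniq.
move=> n; rewrite mem_filter mem_iota => /andP[/andP[kn n2k] _].
by rewrite kn addSn ltnS addnn.
Qed.

Lemma geometric_tail_le lambda N : 1 < lambda ->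
  \sum_(1 <= k < N.+1) (lambda ^+ k)^-1 <= (lambda - 1)^-1.
Proof.
move=> l1; have l0 : 0 < lambda := lt_trans ltr01 l1.
have l1' : lambda - 1 != 0 by rewrite subr_eq0 gt_eqF.
have -> : \sum_(1 <= k < N.+1) (lambda ^+ k)^-1
          = (1 - (lambda ^+ N)^-1) / (lambda - 1).
  elim: N => [|N IHN]; first by rewrite big_geq// expr0 invr1 subrr mul0r.
  rewrite big_nat_recr//= IHN exprS.
  have : lambda ^+ N != 0 by rewrite expf_neq0 ?gt_eqF.
  by move: (lambda ^+ N) => x x0; field; rewrite x0 l1' gt_eqF.
rewrite -[leRHS]mul1r ler_wpM2r ?invr_ge0 ?subr_ge0 ?(ltW l1)//.
by rewrite gerBl invr_ge0 exprn_ge0 ?ltW.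
Qed.

(** Total error in the lower bound for the partial sums: after exchanging the
two sums, [sum_window_le1] bounds the weight of lambda^(-k) by 1. *)
Lemma sum_windows_le lambda N : 1 < lambda ->
  \sum_(1 <= n < N.+1)
     n%:R^-1 * \sum_(1 <= k < n | (n <= k.*2)%N) (lambda ^+ k)^-1
  <= (lambda - 1)^-1.
Proof.
move=> l1; have l0 : 0 < lambda := lt_trans ltr01 l1.
apply: le_trans (geometric_tail_le lambda N l1).
have -> : \sum_(1 <= n < N.+1)
     n%:R^-1 * \sum_(1 <= k < n | (n <= k.*2)%N) (lambda ^+ k)^-1
  = \sum_(1 <= n < N.+1) \sum_(1 <= k < N.+1 | (k < n <= k.*2)%N)
       n%:R^-1 * (lambda ^+ k)^-1.
  apply: eq_big_nat => n /andP[_ nN]; rewrite mulr_sumr.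
  rewrite (big_nat_widen _ _ N.+1) 1?ltnW//.
  by apply: eq_bigl => k; rewrite andbC.
rewrite (exchange_big_dep_nat xpredT)//=.
apply: ler_sum_nat => k /andP[k0 _].
rewrite -mulr_suml ler_piMl ?sum_window_le1//.
by rewrite invr_ge0 exprn_ge0 ?ltW.
Qed.

(** * Sequences with geometric divisor sums *)

Section DivisorSums.
Context (lambda k1 k2 : R) (c : nat -> R).
Context (l1 : 1 < lambda) (k1_gt0 : 0 < k1) (k2_gt0 : 0 < k2).
Context (c_ge0 : forall n, 0 <= c n).
Let e n := \sum_(1 <= d < n.+1 | (d %| n)%N) d%:R * c d.
Context (e_ge : forall n, (0 < n)%N -> k1 * lambda ^+ n <= e n).
Context (e_le : forall n, (0 < n)%N -> e n <= k2 * lambda ^+ n).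

Let l_gt0 n : 0 < lambda ^+ n.
Proof. by rewrite exprn_gt0// (lt_trans ltr01). Qed.

Let e_recr n : (0 < n)%N ->
  e n = \sum_(1 <= d < n | (d %| n)%N) d%:R * c d + n%:R * c n.
Proof.
by move=> n0; rewrite /e big_mkcond big_nat_recr//= dvdnn -big_mkcond.
Qed.

Let term_le n : (0 < n)%N -> n%:R * c n <= k2 * lambda ^+ n.
Proof.
move=> n0; apply: le_trans (e_le n n0); rewrite e_recr// lerDr.
by apply: sumr_ge0 => d _; rewrite mulr_ge0.
Qed.

(** A proper divisor of n is at most n/2. The right-hand side is indexed by
k = n - d, which puts it in the form summed in [sum_windows_le]. *)
Let proper_le n : (0 < n)%N ->
  \sum_(1 <= d < n | (d %| n)%N) d%:R * c d
  <= lambda ^+ n * (k2 * \sum_(1 <= k < n | (n <= k.*2)%N) (lambda ^+ k)^-1).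
Proof.
move=> n0.
apply: (@le_trans _ _ (\sum_(1 <= d < n | (d.*2 <= n)%N) k2 * lambda ^+ d)).
  rewrite big_mkcond [leRHS]big_mkcond; apply: ler_sum_nat => d /andP[d0 dn].
  have [/dvdnP[m Enm]|_] := boolP (d %| n)%N; last first.
    by case: ifP => // _; rewrite mulr_ge0// ltW.
  rewrite ifT ?term_le//.
  move: dn; rewrite Enm -{1}[d]mul1n ltn_pmul2r// => m1.
  by rewrite -mul2n leq_mul2r m1 orbT.
(* substitute d = n - k *)
rewrite mulrCA !mulr_sumr big_nat_rev/=.
rewrite big_mkcond [leRHS]big_mkcond; apply: ler_sum_nat => k /andP[k0 kn].
have -> : (1 + n - k.+1 = n - k)%N by lia.
have -> : ((n - k).*2 <= n)%N = (n <= k.*2)%N by lia.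
case: ifP => // _; rewrite ler_wpM2l ?(ltW k2_gt0)//.
have {2}-> : n = ((n - k) + k)%N by rewrite subnK// ltnW.
by rewrite exprD mulfK// gt_eqF.
Qed.

Let coef_ge n : (0 < n)%N ->
  k1 * n%:R^-1
  - k2 * (n%:R^-1 * \sum_(1 <= k < n | (n <= k.*2)%N) (lambda ^+ k)^-1)
  <= c n / lambda ^+ n.
Proof.
move=> n0; have n0R : (0 : R) < n%:R by rewrite ltr0n.
have := e_ge n n0; rewrite e_recr// => e_lower.
have := lerD (proper_le n n0) (lexx (n%:R * c n)).
move=> /(le_trans e_lower).
set W := \sum_(_ <= _ < _ | _) _ => lower.
have -> : k1 * n%:R^-1 - k2 * (n%:R^-1 * W) = (k1 - k2 * W) / n%:R by ring.
rewrite ler_pdivrMr// mulrAC ler_pdivlMr//.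
lra.
Qed.

Let coef_le n : (0 < n)%N -> c n / lambda ^+ n <= k2 * n%:R^-1.
Proof.
move=> n0; rewrite ler_pdivrMr// mulrAC ler_pdivlMr ?ltr0n//.
by rewrite mulrC term_le.
Qed.

(** The lower bounds k1 and k1 ln N - D for the partial sum A yield
k1 ln N <= A + D <= A (1 + D / k1), whence the constant
k1^2 / (k1 + D). The upper bound k2 (1 + ln N) becomes a multiple of ln N
because 1 <= ln N / ln 2. *)
Lemma partial_sums_asymp_ln : exists s3 s4 : R, [/\ 0 < s3, 0 < s4 &
  forall N, (2 <= N)%N ->
    s3 * ln N%:R <= \sum_(1 <= n < N.+1) c n / lambda ^+ n <= s4 * ln N%:R].
Proof.
have D_gt0 : 0 < k2 / (lambda - 1) by rewrite divr_gt0// subr_gt0.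
have ln2_gt0 : 0 < ln 2 :> R by rewrite ln_gt0// ltr1n.
set D := k2 / _ in D_gt0.
exists (k1 ^+ 2 / (k1 + D)), (k2 * ((ln 2)^-1 + 1)); split.
- by rewrite divr_gt0 ?exprn_gt0 ?addr_gt0.
- by rewrite mulr_gt0 ?addr_gt0 ?invr_gt0.
move=> N N2; have N0 : (0 < N)%N by exact: ltnW.
set A := \sum_(_ <= _ < _) _.
have ge_k1 : k1 <= A.
  (* 1 is the only divisor of 1, so the bound on e 1 is a bound on c 1 *)
  have c1 := e_ge 1 isT; rewrite e_recr// big_geq// add0r mul1r in c1.
  rewrite /A big_ltn//.
  apply: (@le_trans _ _ (c 1 / lambda ^+ 1)); first by rewrite ler_pdivlMr.
  by rewrite lerDl sumr_ge0// => n _; rewrite divr_ge0 ?c_ge0 ?ltW.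
have ge_ln : k1 * ln N%:R - D <= A.
  apply: (@le_trans _ _ (\sum_(1 <= n < N.+1) (k1 * n%:R^-1
    - k2 * (n%:R^-1 * \sum_(1 <= k < n | (n <= k.*2)%N) (lambda ^+ k)^-1)))).
    rewrite sumrB -!mulr_sumr lerB// ler_wpM2l ?(ltW k1_gt0) ?(ltW k2_gt0)//.
      exact: ln_le_harmonic.
    exact: sum_windows_le.
  by apply: ler_sum_nat => n /andP[n0 _]; exact: coef_ge.
have le_H : A <= k2 * (1 + ln N%:R).
  apply: (@le_trans _ _ (\sum_(1 <= n < N.+1) k2 * n%:R^-1)).
    by apply: ler_sum_nat => n /andP[n0 _]; exact: coef_le.
  by rewrite -mulr_sumr ler_wpM2l ?(ltW k2_gt0)// harmonic_le_ln.
apply/andP; split.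
  rewrite mulrAC ler_pdivrMr ?addr_gt0//.
  have := ler_wpM2l (ltW k1_gt0) ge_ln; have := ler_wpM2l (ltW D_gt0) ge_k1.
  by rewrite expr2; nra.
apply: le_trans le_H _; rewrite -mulrA ler_wpM2l ?(ltW k2_gt0)//.
rewrite mulrDl mul1r lerD2r mulrC ler_pdivlMr// mul1r.
by rewrite ler_ln ?posrE ?ltr0n// ler_nat.
Qed.

End DivisorSums.
End Elementary.

Theorem theorem2p3 (R : realType) (M : nat) (Rs : 'I_M -> rational_map R)
    (hdeg : exists i : 'I_M, (2 <= rat_degree (Rs i))%N)
    (f : skew_space R M -> R) (lambda : R) (hlambda : 1 < lambda)
    (hE : asymp_from 1 (E_sum (skew_product Rs) f) (fun n => lambda ^+ n)) :
  asymp_from 2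
    (fun N => (\sum_(1 <= n < N.+1)
                 (C_sum (skew_product Rs) f n / (lambda ^+ n)%:E))%E)
    (fun N => ln N%:R).
Proof.
have [k1 [k2 [k1_gt0 k2_gt0 E_bounds]]] := hE.
set S := skew_product Rs in E_bounds *.
have C_ge0 n : (0 <= C_sum S f n)%E by exact: C_sum_ge0.
(* the sums C_S(f,n) are finite because n C_S(f,n) <= E_S(f,n), so that the
   divisor formula becomes one between real numbers *)
have C_fin n : (0 < n)%N -> C_sum S f n \is a fin_num.
  move=> n0; rewrite ge0_fin_numE//.
  have [_ /le_lt_trans] := E_bounds n n0; move/(_ +oo%E (ltry _)).
  apply: le_lt_trans; apply: le_trans (C_sum_le_E_sum S f n n0).
  by rewrite lee_pemull// lee_fin ler1n.
pose c n := fine (C_sum S f n).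
have E_c n : (0 < n)%N ->
    E_sum S f n = (\sum_(1 <= d < n.+1 | (d %| n)%N) d%:R * c d)%:E.
  move=> n0; rewrite E_sumE// -sumEFin big_nat_cond [RHS]big_nat_cond.
  by apply: eq_bigr => d /andP[/andP[d0 _] _]; rewrite EFinM fineK ?C_fin.
have [s3 [s4 [s3_gt0 s4_gt0 A_bounds]]] := partial_sums_asymp_ln lambda k1 k2 c
  hlambda k1_gt0 k2_gt0 (fun n => fine_ge0 (C_ge0 n))
  (fun n n0 => ltac:(by move: (E_bounds n n0).1; rewrite E_c// lee_fin))
  (fun n n0 => ltac:(by move: (E_bounds n n0).2; rewrite E_c// lee_fin)).
exists s3, s4; split=> // N N2.
have -> : (\sum_(1 <= n < N.+1) C_sum S f n / (lambda ^+ n)%:E)%E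
          = (\sum_(1 <= n < N.+1) c n / lambda ^+ n)%:E.
  rewrite -sumEFin; apply: eq_big_nat => n /andP[n0 _].
  rewrite inver gt_eqF ?exprn_gt0 ?(lt_trans ltr01)//.
  by rewrite EFinM fineK ?C_fin.
by rewrite !lee_fin; apply/andP; exact: A_bounds.
Qed.
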